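(* Given an integer $m\ge0$, let the non-negative integer array $\mathbf r=(r^0,r^1,r^2)$ satisfy $r^2=m$ and $r^\ell\ge2r^{\ell+1}$ for $\ell=0,1$. Let $k\ge2r^0+1\ge8m+1$. Then the following direct decomposition (disjoint union) of the simplicial lattice on a tetrahedron $T$ holds: $$\mathbb T^3_k(T)=\bigoplus_{\ell=0}^3\ \bigoplus_{f\in\Delta_\ell(T)}S_\ell(f,\mathbf r),$$ where $$S_0(\mathtt v,\mathbf r)=D(\mathtt v,r^0),$$ $$S_\ell(f,\mathbf r)=D(f,r^\ell)\setminus\Big[\bigcup_{i=0}^{\ell-1}\bigcup_{e\in\Delta_i(f)}D(e,r^i)\Big],\quad \ell=1,2,$$ $$S_3(T,\mathbf r)=\mathbb T^3_k(T)\setminus\Big[\bigcup_{i=0}^{2}\bigcup_{f\in\Delta_i(T)}D(f,r^i)\Big].$$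
   Context: $T$ is a tetrahedron with vertices indexed by $0,1,2,3$; $\Delta_\ell(T)$ is the set of its $\ell$-dimensional subsimplices, and a subsimplex $f$ is identified with its set of vertex indices $f\subseteq\{0,1,2,3\}$. $\Delta_i(f)$ denotes the $i$-dimensional subsimplices of $f$. The simplicial lattice of degree $k$ is $\mathbb T_k^3(T)=\{\alpha=(\alpha_0,\dots,\alpha_3)\in\mathbb N^4:\alpha_0+\cdots+\alpha_3=k\}$, with $0\in\mathbb N$. For $f\in\Delta_\ell(T)$, $\operatorname{dist}(\alpha,f)=\sum_{i\notin f}\alpha_i$ and $D(f,r)=\{\alpha\in\mathbb T_k^3(T):\operatorname{dist}(\alpha,f)\le r\}$. The symbol $\bigoplus$ for sets denotes a union of pairwise disjoint sets. *)

(* Defs.v *)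
From mathcomp Require Import all_boot all_classical.

Set Implicit Arguments.
Unset Strict Implicit.
Unset Printing Implicit Defensive.

Local Open Scope classical_set_scope.
Local Open Scope nat_scope.

Definition index := {ffun 'I_4 -> nat}.

(* Subsimplices are identified with their sets of vertex indices. *)
Definition simplex := {set 'I_4}.

Definition tetrahedron : simplex := [set: 'I_4]%SET.

Definition subsimplices (i : nat) (f : simplex) : set simplex :=
  [set e : simplex | e \subset f /\ #|e| = i.+1].

Definition lattice (k : nat) : set index :=
  [set a : index | \sum_(i < 4) a i = k].

Definition dist (a : index) (f : simplex) : nat :=
  \sum_(i < 4 | i \notin f) a i.

Definition D (k : nat) (f : simplex) (r : nat) : set index :=
  [set a : index | lattice k a /\ dist a f <= r].

Definition array := 3.-tuple nat.

(* The bound 0 for l >= 3 is never used in the sets S below. *)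
Definition entry (r : array) (l : nat) : nat := nth 0 r l.

Definition lower (k : nat) (r : array) (l : nat) (f : simplex) : set index :=
  \bigcup_(i in [set i : nat | i < l])
    \bigcup_(e in subsimplices i f) D k e (entry r i).

(* Only meant for l <= 3 and f of dimension l. *)
Definition S_ (k : nat) (r : array) (l : nat) (f : simplex) : set index :=
  match l with
  | 0 => D k f (entry r 0)
  | 3 => lattice k `\` lower k r 3 f
  | _ => D k f (entry r l) `\` lower k r l f
  end.

Definition direct_sum (I T : Type) (J : set I) (F : I -> set T) (A : set T) :
    Prop :=
  A = \bigcup_(j in J) F j /\ trivIset J F.

Definition graded_simplices : set (nat * simplex) :=
  [set p | p.1 <= 3 /\ subsimplices p.1 tetrahedron p.2].

(* Main.v *)
(* Since D(e,s) and D(f,t) meet inside D(e `&` f, s + t), two simplices e, f that are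
   not nested, of dimensions l <= l', satisfy
   D(e,r^l) `&` D(f,r^l') `<=` D(e `&` f, 2 r^l), which is empty when e and f are
   disjoint, because 2 r^l < k, and otherwise lies in a set removed from S_l'(f),
   because 2 r^l <= r^(l-1) <= r^i for i < l.  Coverage: a lattice point lies in S_l(f)
   for the smallest l such that it is in D(f,r^l) for some f of dimension l; such an
   l <= 3 exists because D(T,0) is the whole lattice. *)
Require Import Defs.
From mathcomp Require Import all_boot all_classical.
From mathcomp Require Import zify.

Local Open Scope nat_scope.

(** A vertex outside [e :&: f] lies outside [e] or outside [f], so the right-hand side counts its
    coordinate at least once. *)
Lemma dist_setI (a : Defs.index) (e f : simplex) :
  dist a (e :&: f) <= dist a e + dist a f.
Proof.
rewrite /dist big_mkcond [X in _ <= X + _]big_mkcond [X in _ <= _ + X]big_mkcond.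
rewrite -big_split /=; apply: leq_sum => i _; rewrite inE.
by case: (i \in e); case: (i \in f); rewrite /= ?addn0 ?leq_addr.
Qed.

Lemma dist_set0 (a : Defs.index) : dist a finset.set0 = \sum_(i < 4) a i.
Proof. by apply: eq_bigl => i; rewrite inE. Qed.

Lemma dist_tetrahedron (a : Defs.index) : dist a tetrahedron = 0.
Proof. by apply: big1 => i; rewrite inE. Qed.

Lemma card_tetrahedron : #|tetrahedron| = 4.
Proof. by rewrite cardsT card_ord. Qed.

Lemma subsimplices3_tetrahedron (f : simplex) :
  subsimplices 3 tetrahedron f -> f = tetrahedron.
Proof.
by case=> fT f4; apply/eqP; rewrite eqEcard fT f4 card_tetrahedron.
Qed.

(** Spares later proofs a case split on dimension. For [l = 0] the removed union is empty; for
    [l = 3] the simplex is the whole tetrahedron, at distance 0 from every point, so its [D] is the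
    full lattice whatever the bound. *)
Lemma S_E (k : nat) (r : array) (l : nat) (f : simplex) :
  graded_simplices (l, f) ->
  S_ k r l f = (D k f (entry r l) `\` lower k r l f)%classic.
Proof.
case: l => [|[|[|[|l]]]] [] //= _.
  move=> _; apply/seteqP; split=> a //=; last by case.
  by move=> Da; split=> // -[].
move=> /subsimplices3_tetrahedron ->; apply/seteqP; split=> a [] //=.
  by move=> la nlow; split=> //; split=> //; rewrite dist_tetrahedron.
by case=> la _ nlow; split.
Qed.

Lemma entry_double (r : array) (l : nat)
    (hr : forall l : nat, l < 2 -> 2 * entry r l.+1 <= entry r l) :
  2 * entry r l.+1 <= entry r l.
Proof.
(* Past the end of the array, [entry r l.+1] is the default 0. *)
by have [/hr//|l2] := ltnP l 2; rewrite {1}/entry nth_default // size_tuple.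
Qed.

Lemma entry_anti (r : array) (i j : nat)
    (hr : forall l : nat, l < 2 -> 2 * entry r l.+1 <= entry r l) :
  i <= j -> entry r j <= entry r i.
Proof.
move=> /subnK <-; elim: (j - i) => // n IHn; rewrite addSn.
by have := entry_double r (n + i) hr; lia.
Qed.

Lemma D_lower (k : nat) (r : array) (l l' : nat) (e f : simplex) (a : Defs.index)
    (hr : forall l : nat, l < 2 -> 2 * entry r l.+1 <= entry r l)
    (hk : 2 * entry r 0 < k) :
  #|e| = l.+1 -> l <= l' -> ~~ (e \subset f) ->
  D k e (entry r l) a -> D k f (entry r l') a -> lower k r l' f a.
Proof.
move=> el ll' nef [la ae] [_ af].
have aef : dist a (e :&: f) <= 2 * entry r l.
  by have := dist_setI a e f; have := entry_anti r _ _ hr ll'; lia.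
have efl : #|e :&: f| < l.+1.
  rewrite -el proper_card // finset.properEneq finset.subsetIl andbT.
  by apply: contraNneq nef => <-; apply: finset.subsetIr.
case efi: #|e :&: f| efl => [|i] efl.
  (* Disjoint simplices: the distance to the empty set is [k], which exceeds [2 * entry r 0]. *)
  move/eqP: efi aef; rewrite cards_eq0 => /eqP ->.
  by rewrite dist_set0 la; have := entry_anti r _ _ hr (leq0n l); lia.
exists i; first by rewrite /=; lia.
exists (e :&: f); first by split=> //; apply: finset.subsetIr.
(* The face [e :&: f] has dimension [i < l], so [l] is a successor and one doubling step followed by
   monotonicity brings the bound down to index [i]. *)
split=> //; apply: (leq_trans aef); case: l {el ll' ae} efl aef => // l il _.
exact: leq_trans (entry_double _ l hr) (entry_anti _ _ _ hr _).
Qed.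

Lemma S_disjoint (k : nat) (r : array) (l l' : nat) (e f : simplex) (a : Defs.index)
    (hr : forall l : nat, l < 2 -> 2 * entry r l.+1 <= entry r l)
    (hk : 2 * entry r 0 < k) :
  graded_simplices (l, e) -> graded_simplices (l', f) -> l <= l' ->
  S_ k r l e a -> S_ k r l' f a -> (l, e) = (l', f).
Proof.
move=> ge gf ll'; rewrite (S_E _ _ _ _ ge) (S_E _ _ _ _ gf) => -[De _] [Df nlow].
have [/= _ [_ el]] := ge; have [/= _ [_ fl]] := gf.
have ef : e \subset f.
  by apply: contra_notT nlow => nef;
     exact: (D_lower _ _ _ _ _ _ _ hr hk el ll' nef De Df).
move: ll'; rewrite leq_eqVlt => /predU1P[ll'|ll'].
  by rewrite ll'; congr pair; apply/eqP; rewrite finset.eqEcard ef el fl ll' leqnn.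
(* Here [e] is itself one of the proper faces of [f] whose neighbourhoods are removed. *)
by case: nlow; exists l => //; exists e.
Qed.

Lemma lattice_cover (k : nat) (r : array) (a : Defs.index) :
  lattice k a ->
  exists2 p, graded_simplices p & S_ k r p.1 p.2 a.
Proof.
move=> la.
pose P l := `[< exists2 f, subsimplices l tetrahedron f & D k f (entry r l) a >].
have P3 : P 3.
  apply/asboolP; exists tetrahedron; last by split=> //; rewrite dist_tetrahedron.
  by split=> //; exact: card_tetrahedron.
have exP : exists l, P l by exists 3.
case: (ex_minnP exP) => l /asboolP[f fl Df] lmin.
have gf : graded_simplices (l, f) by split=> //; exact: lmin.
exists (l, f) => //=; rewrite S_E //; split=> // -[i /= il [e [ef ei] De]].
(* A removed set containing [a] would contradict the minimality of [l]. *)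
have : l <= i; last by lia.
by apply/lmin/asboolP; exists e => //; split=> //; apply: finset.subsetT.
Qed.

Theorem theorem3p3 (m k : nat) (r : array)
    (hr2 : entry r 2 = m)
    (hr : forall l : nat, l < 2 -> 2 * entry r l.+1 <= entry r l)
    (hk : 2 * entry r 0 + 1 <= k)
    (hm : 8 * m + 1 <= 2 * entry r 0 + 1) :
  direct_sum graded_simplices (fun p : nat * simplex => S_ k r p.1 p.2)
    (lattice k).
Proof.
rewrite addn1 in hk; split.
  apply/seteqP; split=> a; first by move=> /(lattice_cover _ r)[p gp Sp]; exists p.
  by case=> -[l f] gf /=; rewrite S_E // => -[[]].
move=> [l e] [l' f] ge gf [a /= [Se Sf]].
have [ll'|/ltnW l'l] := leqP l l'.
  exact: (S_disjoint _ _ _ _ _ _ _ hr hk ge gf ll' Se Sf).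
by rewrite (S_disjoint _ _ _ _ _ _ _ hr hk gf ge l'l Sf Se).
Qed.
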